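(* Let $A$ and $B$ be hyperbolic isometries of a simplicial tree, such that $AB$ and $A^{-1}B$ act without inversions. Then precisely one of the following holds: (1) The axes of $A$ and $B$ do not intersect. If $k$ is the minimum distance between the two axes, then $l(AB)=l(A^{-1}B)=l(A)+l(B)+2k$. (2) The axes of $A$ and $B$ intersect along a (possibly infinite) path of length $\Delta=\Delta(A,B)\ge 0$, $\max\{l(AB),l(A^{-1}B)\}=l(A)+l(B)$, and either: (i) $\Delta<\min\{l(A),l(B)\}$ and $\min\{l(AB),l(A^{-1}B)\}=l(A)+l(B)-2\Delta$; or (ii) $\Delta>\min\{l(A),l(B)\}$ and $\min\{l(AB),l(A^{-1}B)\}=|l(A)-l(B)|$; or (iii) $\Delta=\min\{l(A),l(B)\}$, either the axes of $B$ and $A^{-1}BA$ (if $l(A)\le l(B)$) or the axes of $A$ and $B^{-1}AB$ (if $l(A)>l(B)$) intersect along a (possibly infinite) path of length $\Delta'\ge 0$, and $$\min\{l(AB),l(A^{-1}B)\}=\begin{cases}|l(A)-l(B)|-2\Delta' & \text{if } \Delta'<\frac{|l(A)-l(B)|}{2},\\ 0 & \text{otherwise.}\end{cases}$$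
   Context: A simplicial tree $T$ has vertex set $V(T)$ and path metric $d$ (edges of length one). Isometries map vertices to vertices; an isometry acts without inversions if it does not swap two adjacent vertices. For an isometry $g$ acting without inversions, $l(g)=\min_{x\in V(T)}d(x,gx)$ is its translation length; $g$ is elliptic if $l(g)=0$ and hyperbolic if $l(g)>0$. The axis of a hyperbolic $g$ is the bi-infinite straight path in $T$ with vertex set $\{x\in V(T): d(x,gx)=l(g)\}$, on which $g$ acts by translation of length $l(g)$. A path of length $0$ is a single vertex. *)

(* Defs.v *)
From HB Require Import structures.
From mathcomp Require Import all_boot all_order all_algebra.
From mathcomp Require Import boolp classical_sets constructive_ereal.

Set Implicit Arguments.
Unset Strict Implicit.
Unset Printing Implicit Defensive.

Local Open Scope classical_set_scope.

(* Classically, an arbitrary type with an arbitrary relation has this form.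
   A [ucycle] of size 2 is an edge traversed back and forth, not a circuit. *)
Record tree := Tree {
  vertex :> eqType;
  adj : rel vertex;
  adj_sym : symmetric adj;
  adj_irr : irreflexive adj;
  tree_nonempty : inhabited vertex;
  tree_connected : forall x y : vertex,
    exists2 p : seq vertex, path adj x p & last x p = y;
  tree_acyclic : forall c : seq vertex, ucycle adj c -> (size c <= 2)%N
}.

(* The junk value for the empty set is 0; [least] is only applied below to
   nonempty sets. *)
Definition least (S : set nat) : nat :=
  get [set k | S k /\ forall m, S m -> (k <= m)%N].

Definition dist (T : tree) (x y : T) : nat :=
  least [set n | exists p : seq T,
                   [/\ path (@adj T) x p, last x p = y & size p = n]].

Record tree_isometry (T : tree) := Isometry {
  isom_fun :> T -> T;
  isom_invfun : T -> T;
  isom_funK : cancel isom_fun isom_invfun;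
  isom_invfunK : cancel isom_invfun isom_fun;
  isom_dist : forall x y, dist (isom_fun x) (isom_fun y) = dist x y
}.

Lemma isom_inv_dist (T : tree) (g : tree_isometry T) (x y : T) :
  dist (isom_invfun g x) (isom_invfun g y) = dist x y.
Proof. by rewrite -(isom_dist g) !isom_invfunK. Qed.

Definition isom_inv (T : tree) (g : tree_isometry T) : tree_isometry T :=
  Isometry (@isom_invfunK T g) (@isom_funK T g) (isom_inv_dist g).

Lemma isom_mul_dist (T : tree) (g h : tree_isometry T) (x y : T) :
  dist ((g \o h) x) ((g \o h) y) = dist x y.
Proof. by rewrite /= !isom_dist. Qed.

Definition isom_mul (T : tree) (g h : tree_isometry T) : tree_isometry T :=
  Isometry (can_comp (@isom_funK T g) (@isom_funK T h))
           (can_comp (@isom_invfunK T h) (@isom_invfunK T g))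
           (isom_mul_dist g h).

Declare Scope isom_scope.
Delimit Scope isom_scope with isom.
Bind Scope isom_scope with tree_isometry.
Notation "g * h" := (isom_mul g h) : isom_scope.
Notation "g ^-1" := (isom_inv g) : isom_scope.

Definition without_inversions (T : tree) (g : tree_isometry T) : Prop :=
  forall x y : T, adj x y -> ~ (g x = y /\ g y = x).

Definition tlen (T : tree) (g : tree_isometry T) : nat :=
  least [set n | exists x : T, dist x (g x) = n].

(* An inversion also has positive [tlen], hence the first conjunct. *)
Definition hyperbolic (T : tree) (g : tree_isometry T) : Prop :=
  without_inversions g /\ (0 < tlen g)%N.

(* Subtrees are represented by their vertex sets. *)
Definition axis (T : tree) (g : tree_isometry T) : set T :=
  [set x | dist x (g x) = tlen g].

Definition set_dist (T : tree) (X Y : set T) : nat :=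
  least [set n | exists x y, [/\ X x, Y y & dist x y = n]].

Definition finite_path (T : tree) (S : set T) (n : nat) : Prop :=
  exists (x : T) (p : seq T),
    [/\ path (@adj T) x p, uniq (x :: p), size p = n & S = [set` x :: p]].

Definition ray (T : tree) (S : set T) : Prop :=
  exists r : nat -> T,
    [/\ injective r, forall n, adj (r n) (r n.+1) & S = range r].

Definition line (T : tree) (S : set T) : Prop :=
  exists r : int -> T,
    [/\ injective r, forall n, adj (r n) (r (n + 1)%R) & S = range r].

(* The length is a natural number or [+oo]. *)
Definition path_of_length (T : tree) (S : set T) (L : \bar int) : Prop :=
  (exists2 n : nat, L = (n%:Z)%:E & finite_path S n) \/
  (L = +oo%E /\ (ray S \/ line S)).

Definition exactly_one (Ps : seq Prop) : Prop := exists! i, nth False Ps i.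

(* Main.v *)
(* In a tree the distance to a fixed vertex first decreases and then increases
   along a geodesic; this gives medians and the four-point inequality, from
   which l(g) = max(0, d(x, g^2 x) - d(x, g x)) for every vertex x and every g
   without inversions. All translation lengths are then read off well chosen
   points. If q lies on [A p, B p] and p on [B^-1 q, A^-1 q], the orbit of p
   under A^-1 B runs along a geodesic; this covers disjoint axes, the larger of
   the two lengths, and overlaps shorter than min(a, b). For longer overlaps, x
   on both axes gives d(x, A^-1 B x) = b - a if a <= b, and the orbit of x
   backtracks exactly when the overlap equals a, by the length of the
   intersection of the axes of B and A^-1 B A. Replacing B by B^-1 exchanges
   l(AB) and l(A^-1 B), so that the axes may be assumed to be translated in the
   same direction. *)
Require Import Defs.
From mathcomp Require Import all_boot all_order all_algebra.
From mathcomp Require Import boolp classical_sets constructive_ereal.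
From mathcomp Require Import zify.

Import Order.TTheory GRing.Theory Num.Theory.

Set Implicit Arguments.
Unset Strict Implicit.
Unset Printing Implicit Defensive.

Local Open Scope classical_set_scope.

(** * The metric of a tree *)

Lemma leastP (S : set nat) n :
  S n -> S (least S) /\ forall m, S m -> (least S <= m)%N.
Proof.
move=> Sn; rewrite /least; apply: (@getPex _ [set k | S k /\ forall m, S m -> (k <= m)%N]).
have exS : exists k, `[< S k >] by exists n; apply/asboolP.
case: (ex_minnP exS) => k /asboolP Sk kmin; exists k; split => // m Sm.
by apply: kmin; apply/asboolP.
Qed.

Section TreeMetric.
Variable T : tree.
Implicit Types x y z w m : T.

Lemma geodesic_path x y :
  exists p : seq T, [/\ path (@adj T) x p, last x p = y & size p = dist x y].
Proof.
have [p px py] := tree_connected x y.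
have [] := @leastP [set n | exists p : seq T,
  [/\ path (@adj T) x p, last x p = y & size p = n]] (size p); first by exists p.
by [].
Qed.

Lemma dist_path_le x (p : seq T) : path (@adj T) x p -> dist x (last x p) <= size p.
Proof.
move=> px.
have [] := @leastP [set n | exists q : seq T,
  [/\ path (@adj T) x q, last x q = last x p & size q = n]] (size p); first by exists p.
by move=> _; apply; exists p.
Qed.

Lemma distxx x : dist x x = 0.
Proof. by have := @dist_path_le x [::] isT; rewrite leqn0 => /eqP. Qed.

Lemma dist0_eq x y : dist x y = 0 -> x = y.
Proof.
by have [p [_ py sp]] := geodesic_path x y => d0; case: p py sp => //=; rewrite d0.
Qed.

Lemma dist_sym_le x y : dist y x <= dist x y.
Proof.
have [p [px <- <-]] := geodesic_path x y.
have := @dist_path_le (last x p) (rev (belast x p)).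
rewrite rev_path size_rev size_belast.
have -> : last (last x p) (rev (belast x p)) = x.
  by case: p px => //= y0 p _; rewrite rev_cons last_rcons.
by apply; rewrite (eq_path (e' := @adj T)) // => u v; rewrite adj_sym.
Qed.

Lemma distC x y : dist x y = dist y x.
Proof. by apply/eqP; rewrite eqn_leq !dist_sym_le. Qed.

Lemma dist_triangle y x z : dist x z <= dist x y + dist y z.
Proof.
have [p [px py <-]] := geodesic_path x y.
have [q [qx qz <-]] := geodesic_path y z.
have := @dist_path_le x (p ++ q); rewrite cat_path last_cat size_cat px py qz.
exact.
Qed.

Lemma dist1_adj x y : (dist x y == 1) = adj x y.
Proof.
apply/idP/idP => [/eqP d1|xy].
  have [p [+ + +]] := geodesic_path x y; rewrite d1.
  by case: p => [|u [|v p]] //= /andP[xu _] <-.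
have := @dist_path_le x [:: y]; rewrite /= xy => /(_ isT).
case E: (dist x y) => [|[]] // _.
by rewrite (dist0_eq E) adj_irr in xy.
Qed.

Lemma geodesic_point x y k : k <= dist x y ->
  exists z, dist x z = k /\ dist z y = dist x y - k.
Proof.
have [p [px py sp]] := geodesic_path x y => kd.
have := px; rewrite -{1}(cat_take_drop k p) cat_path => /andP[p1 p2].
set z := last x (take k p) in p2; exists z.
have := dist_path_le p1; rewrite size_take_min -/z => l1.
have := dist_path_le p2; rewrite size_drop -last_cat cat_take_drop py => l2.
have := dist_triangle z x y; lia.
Qed.

(* Extending both ends by one step towards [x] keeps the path simple, since
   the new vertices are on a lower level, until the ends meet in a circuit. *)
Lemma no_level_path x k y (p : seq T) :
  p != [::] -> path (@adj T) y p -> uniq (y :: p) ->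
  dist x y = k -> dist x (last y p) = k -> all (fun z => k <= dist x z) p -> False.
Proof.
elim: k y p => [|k IH] y p p0 py up dy dl ap.
  move/dist0_eq: dy py up dl => <- _ up /dist0_eq xl.
  by case: p p0 up {ap} xl => //= u p _ /andP[/negP nx _] xl; apply: nx; rewrite {1}xl mem_last.
have lower z : dist x z = k -> z \notin y :: p.
  move=> dz; rewrite inE negb_or; apply/andP; split.
    by apply/eqP => zy; move: dz; rewrite zy dy; lia.
  by apply/negP => /(allP ap); rewrite dz ltnn.
have parent z : dist x z = k.+1 -> exists2 z', dist x z' = k & adj z' z.
  move=> dz; have [|z' [d1 d2]] := @geodesic_point x z k; first by rewrite dz.
  by exists z' => //; rewrite -dist1_adj d2 dz subSnn.
have [y' dy' ay] := parent _ dy; have [z dz az] := parent _ dl.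
have [yz|yz] := eqVneq y' z.
  have := @tree_acyclic T (y' :: y :: p).
  rewrite /ucycle /cycle /= rcons_path ay py yz adj_sym az /= => /(_ _) H.
  have {}H := H _; case: p p0 py up dl ap lower az H => // u p _ py up dl ap lower az.
  by rewrite -cons_uniq up -yz (lower _ dy') /= => /(_ isT).
apply: (IH y' (rcons (y :: p) z)) => //.
- by rewrite rcons_path /= ay py adj_sym az.
- by rewrite cons_uniq rcons_uniq up mem_rcons inE negb_or yz !lower.
- by rewrite last_rcons.
- rewrite all_rcons /= dz dy leqnn leqnSn /=.
  by apply: sub_all ap => v; apply: ltnW.
Qed.

Lemma adj_dist x y z : adj y z ->
  dist x z = (dist x y).+1 \/ dist x y = (dist x z).+1.
Proof.
move=> yz; have /eqP d1 : dist y z == 1 by rewrite dist1_adj.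
have t1 := dist_triangle y x z; have t2 := dist_triangle z x y.
have d2 := distC y z.
have [E|] := eqVneq (dist x y) (dist x z); last lia.
exfalso; apply: (@no_level_path x (dist x y) y [:: z]) => //=.
- by rewrite yz.
- by rewrite inE andbT; apply/eqP => yz'; rewrite yz' adj_irr in yz.
- by rewrite E leqnn.
Qed.

(** Otherwise [u], [y], [v] is a simple path whose ends share a level and which never goes below
    it. *)
Lemma parent_unique x y u v : adj y u -> adj y v ->
  dist x y = (dist x u).+1 -> dist x y = (dist x v).+1 -> u = v.
Proof.
move=> yu yv du dv; apply/eqP/negPn/negP => uv.
have nu : u != y by apply/eqP => E; rewrite E adj_irr in yu.
have nv : y != v by apply/eqP => E; rewrite E adj_irr in yv.
apply: (@no_level_path x (dist x u) u [:: y; v]) => //=.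
- by rewrite adj_sym yu yv.
- by rewrite !inE negb_or nu nv uv.
- lia.
- by apply/and3P; split => //; lia.
Qed.

(** A decrease after the increase would give the turning vertex two neighbours on the level below,
    one on either side along the geodesic. *)
Lemma geodesic_leave n x y u v : dist y u = 1 -> dist u v = n -> dist y v = n.+1 ->
  dist x u = (dist x y).+1 -> dist x v = dist x y + n.+1.
Proof.
elim: n y u => [|n IH] y u yu uv yv xu.
  by rewrite -(dist0_eq uv) xu addn1.
have [|w [uw wv]] := @geodesic_point u v 1; first by rewrite uv.
have t := dist_triangle w y v.
have yw : y <> w by move=> E; move: t wv yv; rewrite -E distxx; lia.
have auw : adj u w by rewrite -dist1_adj uw.
have [xw|xw] := @adj_dist x u w auw.
  by rewrite (IH u w) //; [lia|rewrite wv uv; lia].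
case: yw; apply: (@parent_unique x u) => //.
by rewrite adj_sym -dist1_adj yu.
Qed.

(** At most one of the two neighbours of [m] on the geodesic is closer to [y]; on the other side the
    distance to [y] increases all the way. *)
Lemma between_or z w m y : dist z w = dist z m + dist m w ->
  dist y z = dist y m + dist m z \/ dist y w = dist y m + dist m w.
Proof.
move=> zmw.
have [/dist0_eq->|z0] := eqVneq (dist m z) 0; first by left; rewrite distxx addn0.
have [/dist0_eq->|w0] := eqVneq (dist m w) 0; first by right; rewrite distxx addn0.
have [|u [mu uz]] := @geodesic_point m z 1; first lia.
have [|v [mv vw]] := @geodesic_point m w 1; first lia.
have cz := distC m z; have cu := distC u z.
have uv : u <> v by move=> E; have := dist_triangle u z w; rewrite {2}E; lia.
have au : adj m u by rewrite -dist1_adj mu.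
have av : adj m v by rewrite -dist1_adj mv.
have [yu|yu] := @adj_dist y m u au.
  left; rewrite (@geodesic_leave (dist u z) y m u z) //; lia.
have [yv|yv] := @adj_dist y m v av.
  right; rewrite (@geodesic_leave (dist v w) y m v w) //; lia.
by case: uv; apply: (@parent_unique y m).
Qed.

(** [m] is a point nearest to [x] on the geodesic from [z] to [w]; the distance to [x] increases on
    both sides of it. *)
Lemma median x z w : exists m,
  [/\ dist z w = dist z m + dist m w, dist x z = dist x m + dist m z
    & dist x w = dist x m + dist m w].
Proof.
set S := [set n | exists2 m, dist z w = dist z m + dist m w & dist x m = n].
have [] := @leastP S (dist x z); first by exists z => //; rewrite distxx.
case=> m zmw dm min; exists m; split => //.
  have [/dist0_eq->|z0] := eqVneq (dist m z) 0; first by rewrite distxx addn0.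
  have [|u [mu uz]] := @geodesic_point m z 1; first lia.
  have au : adj m u by rewrite -dist1_adj mu.
  have [xu|xu] := @adj_dist x m u au.
    rewrite (@geodesic_leave (dist u z) x m u z) //; lia.
  have /min : S (dist x u).
    exists u => //; have := dist_triangle u z w; have := dist_triangle m u w.
    have := distC m z; have := distC u z; have := distC m u; lia.
  lia.
have [/dist0_eq->|z0] := eqVneq (dist m w) 0; first by rewrite distxx addn0.
have [|u [mu uz]] := @geodesic_point m w 1; first lia.
have au : adj m u by rewrite -dist1_adj mu.
have [xu|xu] := @adj_dist x m u au.
  rewrite (@geodesic_leave (dist u w) x m u w) //; lia.
have /min : S (dist x u).
  exists u => //; have := dist_triangle u z w; have := dist_triangle m z u.
  lia.
lia.
Qed.

(** From [y], one of [z] and [w] is reached through the median of [x], [z], [w]. *)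
Lemma four_point x y z w :
  dist x y + dist z w <= maxn (dist x z + dist y w) (dist x w + dist y z).
Proof.
have [m [zw xz xw]] := median x z w.
have := dist_triangle m x y; have := distC m y; have := distC z m.
have [] := between_or y zw; lia.
Qed.

Lemma dist_triangle_even x y z : ~~ odd (dist x y + dist y z + dist x z).
Proof.
have [m [zw xz xw]] := median x y z.
suff -> : dist x y + dist y z + dist x z = (dist x m + dist m y + dist m z).*2.
  by rewrite odd_double.
by rewrite zw xz xw (distC y m) -muln2; lia.
Qed.

(** Positivity of the overlap excludes one term of the four-point maximum, so that the two geodesics
    glue. *)
Lemma dist_chain w x y z : dist w y = dist w x + dist x y ->
  dist x z = dist x y + dist y z -> 0 < dist x y ->
  dist w z = dist w x + dist x y + dist y z.
Proof.
move=> wy xz xy; have := four_point w y x z.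
have := dist_triangle x w z; have := distC y x; have := dist_triangle y x z; lia.
Qed.

(** The last hypothesis bounds the Gromov product of [p] and [q] at [c] below by [k]: the geodesics
    to them share their first [k] edges. *)
Lemma geodesic_branch c p q y z k : dist c y = k -> dist c z = k ->
  dist c p = k + dist y p -> dist c q = k + dist z q ->
  dist p q + 2 * k <= dist c p + dist c q -> y = z.
Proof.
move=> cy cz cp cq pq; apply: dist0_eq.
have := four_point c p y q; have := four_point c q y z.
have := distC p y; have := distC q y; have := distC q z.
have := distC y z; lia.
Qed.

Lemma geodesic_unique c p y z :
  dist c y = dist c z -> dist c p = dist c y + dist y p ->
  dist c p = dist c z + dist z p -> y = z.
Proof.
move=> e cy cz; apply: (@geodesic_branch c p p y z (dist c y)) => //; try lia.
by rewrite distxx; lia.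
Qed.

End TreeMetric.

(** * Translation lengths and axes *)

Definition geodesic_line (T : tree) (r : int -> T) :=
  forall i j, dist (r i) (r j) = absz (i - j)%R.

Section Lines.
Variable T : tree.
Implicit Types (r s : int -> T) (x y : T) (i j m : int).

(** Induction on the length: a segment and the next two edges overlap in one edge, where
    [dist_chain] glues them. *)
Lemma local_geodesic_line r :
  (forall i, dist (r i) (r (i + 1)%R) = 1) ->
  (forall i, dist (r i) (r (i + 2)%R) = 2) -> geodesic_line r.
Proof.
move=> r1 r2.
have fwd n i : dist (r i) (r (i + n%:Z)%R) = n.
  elim: n {-2}n (leqnn n) => [|n IH] k.
    by rewrite leqn0 => /eqP->; rewrite (_ : (i + 0%:Z = i)%R) ?distxx //; lia.
  case: k => [|[|k]] kn.
  - by rewrite (_ : (i + 0%:Z = i)%R) ?distxx //; lia.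
  - exact: r1.
  have e1 := IH k.+1 kn; have e0 := IH k (ltnW kn).
  have s1 := r1 (i + k%:Z)%R; have s2 := r2 (i + k%:Z)%R.
  have s3 := r1 (i + k.+1%:Z)%R.
  rewrite (_ : (i + k%:Z + 1 = i + k.+1%:Z)%R) in s1; last lia.
  rewrite (_ : (i + k%:Z + 2 = i + k.+2%:Z)%R) in s2; last lia.
  rewrite (_ : (i + k.+1%:Z + 1 = i + k.+2%:Z)%R) in s3; last lia.
  by rewrite (@dist_chain T _ (r (i + k%:Z)%R) (r (i + k.+1%:Z)%R)); lia.
move=> i j; have [ij|ij] : (i <= j)%R \/ (j <= i)%R by lia.
  rewrite -{1}(_ : (i + (absz (j - i)%R)%:Z = j)%R); last lia.
  by rewrite fwd; lia.
rewrite distC -{1}(_ : (j + (absz (i - j)%R)%:Z = i)%R); last lia.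
by rewrite fwd.
Qed.

Lemma geodesic_line_inj r i j : geodesic_line r -> r i = r j -> i = j.
Proof. by move=> rl e; have := rl i j; rewrite e distxx; lia. Qed.

(** The median of [y], [r m], [r j] is on the line; as [r m] is nearest to [y], the median equals
    [r m]. *)
Lemma line_gate r y : geodesic_line r ->
  exists m, forall j, dist y (r j) = dist y (r m) + absz (m - j)%R.
Proof.
move=> rl.
have [|[m dm] min] := @leastP [set n | exists m, dist y (r m) = n] (dist y (r 0%R)).
  by exists 0%R.
exists m => j; have [z [e1 e2 e3]] := median y (r m) (r j).
have [k kz] : exists k, r k = z.
  have mj := rl m j; have c := distC z (r j); have c' := distC (r m) z.
  exists (if (m <= j)%R then (m + (dist (r m) z)%:Z)%R else (m - (dist (r m) z)%:Z)%R).
  case: ifP => mj'; apply: (@geodesic_unique _ (r m) (r j)); rewrite ?rl //; lia.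
have mk := min (dist y (r k)) (ex_intro _ k erefl).
have e : dist z (r m) = 0 by rewrite -kz in e2 *; lia.
by move/dist0_eq: e e3 => ->; rewrite rl.
Qed.

End Lines.

Section Isometries.
Variable T : tree.
Implicit Types (g : tree_isometry T) (x y u v : T).

Lemma tlen_attained g : exists x, dist x (g x) = tlen g.
Proof.
have [x0] := tree_nonempty T.
have [] := @leastP [set n | exists x : T, dist x (g x) = n] (dist x0 (g x0)).
  by exists x0.
by [].
Qed.

Lemma tlen_le g x : tlen g <= dist x (g x).
Proof.
have [|_ min] := @leastP [set n | exists y : T, dist y (g y) = n] (dist x (g x)).
  by exists x.
by apply: min; exists x.
Qed.

(** [g u] and [v] are at distance [k] from [g x] on the geodesics to [g (g x)] and to [x], which
    agree that far by the first hypothesis. *)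
Lemma isom_fold g x u v k :
  2 * k + dist x (g (g x)) <= 2 * dist x (g x) ->
  dist x u = k -> k + dist u (g x) = dist x (g x) ->
  dist (g x) v = k -> k + dist v x = dist x (g x) -> g u = v.
Proof.
move=> le xu ug xv vx; apply: (@geodesic_branch _ (g x) (g (g x)) x _ _ k) => //.
- by rewrite isom_dist.
- by rewrite !isom_dist.
- by rewrite distC.
- by rewrite (distC (g (g x))) isom_dist (distC (g x) x); lia.
Qed.

(* [dist x (g (g x)) = 2 * l + 2 * k] and [dist x (g x) = l + 2 * k] when [x]
   is at distance [k] from the axis; for elliptic [g] the truncated difference
   is 0. *)
Lemma tlenE g x : without_inversions g ->
  tlen g = dist x (g (g x)) - dist x (g x).
Proof.
move=> ng; apply/eqP; rewrite eqn_leq; apply/andP; split; last first.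
  (* The difference is at most [tlen g] by the four-point inequality with a point [y] of least
     displacement. *)
  have [y <-] := tlen_attained g.
  have := four_point x (g (g x)) (g x) (g y).
  have := dist_triangle y x (g y); have := dist_triangle (g y) (g x) y.
  have := distC (g (g x)) (g x); have := distC (g x) y.
  rewrite !isom_dist; have := distC (g y) y; have := distC x y.
  lia.
(* [k] is the length of the backtracking at [g x], an integer by parity. *)
have [k Dk] : exists k, dist x (g (g x)) + 2 * k = 2 * dist x (g x).
  have := dist_triangle_even x (g x) (g (g x)); rewrite isom_dist => ev.
  have := dist_triangle (g x) x (g (g x)); rewrite isom_dist => tr.
  by exists (uphalf (2 * dist x (g x) - dist x (g (g x)))); lia.
(* Removing [k] edges at both ends of the geodesic from [x] to [g x] leaves a segment from [u] to
   [g u]. *)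
have [Dn|Dn] := leqP (dist x (g x)) (dist x (g (g x))).
  have [|u [xu ug]] := @geodesic_point T x (g x) k; first lia.
  have [|v [uv vg]] := @geodesic_point T u (g x) (dist x (g x) - 2 * k); first lia.
  have gu : g u = v.
    apply: (@isom_fold g x u v k) => //; rewrite ?(distC (g x) v) ?(distC v x); try lia.
    have := dist_triangle u x v; have := dist_triangle v x (g x); lia.
  by apply: (leq_trans (tlen_le g u)); rewrite gu uv; lia.
(* The geodesic now folds beyond its middle: the midpoint is fixed if the length is even, the middle
   edge is inverted if it is odd. *)
suff [y yg] : exists y, g y = y.
  by apply: (leq_trans (tlen_le g y)); rewrite yg distxx.
have [|u [xu ug]] := @geodesic_point T x (g x) (dist x (g x))./2; first lia.
have cu := distC x u; have cg := distC u (g x).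
have [on|en] := boolP (odd (dist x (g x))); last first.
  by exists u; apply: (@isom_fold g x u u (dist x (g x))./2) => //; lia.
have [|v [uv vg]] := @geodesic_point T u (g x) 1; first lia.
have xv : dist x v = (dist x (g x))./2.+1.
  have := dist_triangle u x v; have := dist_triangle v x (g x); lia.
have cv := distC x v; have cvg := distC v (g x).
case: (ng u v); first by rewrite -dist1_adj uv.
split.
  by apply: (@isom_fold g x u v (dist x (g x))./2) => //; lia.
by apply: (@isom_fold g x v u (dist x (g x))./2.+1) => //; lia.
Qed.

(** * Integer powers and the axis of a hyperbolic isometry *)

Definition ipow g (k : int) (x : T) : T :=
  match k with Posz n => iter n g x | Negz n => iter n.+1 (isom_invfun g) x end.

Lemma ipowS g k x : ipow g (k + 1)%R x = g (ipow g k x).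
Proof.
case: k => n.
  by rewrite (_ : (n%:Z + 1 = n.+1%:Z)%R) //; lia.
rewrite /= isom_invfunK; case: n => [|n] //.
by rewrite (_ : (Negz n.+1 + 1 = Negz n)%R) //; lia.
Qed.

Lemma ipow_dist g k x y : dist (ipow g k x) (ipow g k y) = dist x y.
Proof.
case: k => n /=; last first.
  by rewrite isom_inv_dist; elim: n => //= n IH; rewrite isom_inv_dist.
by elim: n => //= n IH; rewrite isom_dist.
Qed.

Lemma ipowD g k j x : ipow g (k + j)%R x = ipow g k (ipow g j x).
Proof.
have pos (n : nat) i : ipow g (n%:Z + i)%R x = ipow g n (ipow g i x).
  elim: n => [|n IH]; first by rewrite add0r.
  by rewrite (_ : (n.+1%:Z + i = n%:Z + i + 1)%R) ?ipowS ?IH //; lia.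
case: k => n; first exact: pos.
apply: dist0_eq; rewrite -(ipow_dist g n.+1) -pos NegzE addNKr.
rewrite [X in dist _ X](_ : _ = ipow g j x) ?distxx //.
have iterK m z : iter m g (iter m (isom_invfun g) z) = z.
  by elim: m => // m IH; rewrite iterSr iterS isom_invfunK IH.
exact: (iterK n.+1).
Qed.

(** The line consists of the translates of a geodesic from a point [x] of least displacement to
    [g x]. By [tlenE], [x] and [g (g x)] are at distance [2 l], so nothing backtracks at the
    joints. *)
Lemma axis_line g : hyperbolic g ->
  exists r : int -> T, [/\ geodesic_line r,
    forall i, g (r i) = r (i + (tlen g)%:Z)%R & axis g = range r].
Proof.
case=> ng l0; have [x xg] := tlen_attained g.
have xgg : dist x (g (g x)) = 2 * tlen g by have := tlenE x ng; lia.
set l := tlen g in l0 xg xgg *.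
have /choice[u hu] : forall k : nat, exists z, k <= l ->
    dist x z = k /\ dist z (g x) = l - k.
  move=> k; have [kl|kl] := leqP k l; last by exists x; lia.
  have [|z] := @geodesic_point T x (g x) k; first by rewrite xg.
  by rewrite xg; exists z.
have u0 : u 0 = x by have [/dist0_eq] := hu 0 isT.
have ul : u l = g x by have [_] := hu l (leqnn l); rewrite subnn => /dist0_eq.
have uu i j : i <= j -> j <= l -> dist (u i) (u j) = j - i.
  move=> ij jl.
  have il := leq_trans ij jl; have [z [uz zg]] : exists z,
      dist (u i) z = j - i /\ dist z (g x) = dist (u i) (g x) - (j - i).
    by apply: geodesic_point; have [_] := hu i il; lia.
  have [xi ig] := hu i il; have [xj jg] := hu j jl.
  suff -> : u j = z by [].
  have := dist_triangle (u i) x z; have := dist_triangle z x (g x).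
  by move=> t1 t2; apply: (@geodesic_unique T (g x) x);
    rewrite ?(distC (g x)) ?(distC _ x); lia.
have ugu i j : i <= l -> j <= l -> dist (u i) (g (u j)) = l - i + j.
  move=> il jl; have [xi ig] := hu i il; have [xj jg] := hu j jl.
  have := dist_triangle (u i) x (g (g x)).
  have := dist_triangle (g (u j)) (u i) (g (g x)).
  have := dist_triangle (g x) (u i) (g (u j)).
  rewrite !isom_dist; lia.
pose r (i : int) := ipow g (i %/ l)%Z (u (absz (i %% l)%Z)).
have rS i : g (r i) = r (i + l%:Z)%R.
  rewrite /r -ipowS divzDr ?modzDr ?dvdzz // divzz.
  by rewrite (_ : (l%:Z != 0)%R) //; lia.
have rsmall (n : nat) : n <= l -> r (Posz n) = u n.
  rewrite leq_eqVlt => /orP[/eqP->|nl].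
    have := rS 0%R; rewrite add0r => <-.
    by rewrite /r div0z mod0z /= u0 ul.
  by rewrite /r divz_small ?modz_small //; lia.
(* A power of [g] moves any index into the first segment, so that distances one and two need
   checking only there. *)
have shift i : exists2 n : nat, n < l & exists k, forall j,
    r (i + j)%R = ipow g k (r (n%:Z + j)%R).
  exists (absz (i %% l)%Z); first lia.
  exists (i %/ l)%Z => j.
  have rk k e : r (k * l%:Z + e)%R = ipow g k (r e).
    by rewrite /r divzMDl ?modzMDl ?ipowD //; lia.
  by rewrite -rk; congr r; lia.
have rl : geodesic_line r.
  apply: local_geodesic_line => i.
    have [n nl [k kr]] := shift i.
    have := kr 0%R; rewrite !addr0 => ->; rewrite kr ipow_dist.
    rewrite (_ : (n%:Z + 1)%R = Posz n.+1); last lia.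
    rewrite !rsmall ?uu //; lia.
  have [n nl [k kr]] := shift i.
  have := kr 0%R; rewrite !addr0 => ->; rewrite kr ipow_dist.
  have [nl'|nl'] := leqP n.+2 l.
    rewrite (_ : (n%:Z + 2)%R = Posz n.+2); last lia.
    rewrite !rsmall ?uu //; lia.
  rewrite (_ : (n%:Z + 2)%R = (1%:Z + l%:Z)%R); last lia.
  by rewrite -rS !rsmall ?ugu //; lia.
exists r; split => //; apply/seteqP; split => [y /= yg|_ [i _ <-]] /=; last first.
  by rewrite /axis /= rS rl; lia.
(* A point at distance [h > 0] from the line is displaced by [l + 2 h]. *)
have [m gate] := line_gate y rl; exists m => //.
have [//|/negPf h0] := eqVneq (dist y (r m)) 0; first by move/dist0_eq.
have c1 := gate (m + l%:Z)%R; have c2 := gate (m - l%:Z)%R.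
have := dist_chain (w := y) (x := r m) (y := r (m + l%:Z)%R) (z := g y).
have := isom_dist g y (r (m - l%:Z)%R); have := isom_dist g y (r m).
rewrite !rS subrK (distC (g y) (r m)) (distC (g y)) rl; rewrite /axis /= -/l in yg.
lia.
Qed.

End Isometries.

(** * Intersections of lines *)

Lemma down_closed_nat (K : set nat) : K 0 ->
  (forall i j, i <= j -> K j -> K i) ->
  (exists n, forall i, K i <-> i <= n) \/ (forall i, K i).
Proof.
move=> K0 Kd; have [|nK] := pselect (forall i, K i); first by right.
have [n nKn] : exists n, ~ K n by apply/existsNP.
have [] := @leastP [set n | ~ K n] n nKn.
case: (least _) => [//|l] nKl lmin; left; exists l => i; split => [Ki|il].
  by rewrite leqNgt; apply/negP => /Kd /(_ Ki).
by apply: contrapT => /lmin; rewrite ltnNge il.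
Qed.

Section Overlaps.
Variable T : tree.
Implicit Types (r s : int -> T) (A B g h : tree_isometry T) (i j lo : int).

Lemma geodesic_line_adj r i : geodesic_line r -> adj (r i) (r (i + 1)%R).
Proof. by move=> rl; rewrite -dist1_adj rl; lia. Qed.

Lemma finite_path_segment r lo (n : nat) : geodesic_line r ->
  finite_path (r @` [set i | (lo <= i <= lo + n%:Z)%R]) n.
Proof.
move=> rl; exists (r (lo + 0%:Z)%R), [seq r (lo + k%:Z)%R | k <- iota 1 n].
have E : r (lo + 0%:Z)%R :: [seq r (lo + k%:Z)%R | k <- iota 1 n] =
    [seq r (lo + k%:Z)%R | k <- iota 0 n.+1] by [].
split.
- elim: n 0 {E} => //= n IH m; rewrite IH andbT.
  rewrite (_ : (lo + m.+1%:Z = lo + m%:Z + 1)%R); last lia.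
  exact: geodesic_line_adj.
- rewrite E map_inj_uniq ?iota_uniq // => i j /(geodesic_line_inj rl); lia.
- by rewrite size_map size_iota.
rewrite E; apply/seteqP; split => [_ [i /= ilo <-]|y /mapP[k]].
  suff: r i \in [seq r (lo + k%:Z)%R | k <- iota 0 n.+1] by [].
  apply/mapP; exists (absz (i - lo)%R); first by rewrite mem_iota; lia.
  by congr r; lia.
by rewrite mem_iota => kn ->; exists (lo + k%:Z)%R => //=; lia.
Qed.

(** Path, ray or line according to the number of sides on which [I] is unbounded. The pairs of
    indices at every distance are the form in which the computations of translation lengths use
    infiniteness. *)
Lemma convex_image_path r (I : set int) i0 : geodesic_line r -> I i0 ->
  (forall i j k, I i -> I k -> (i <= j <= k)%R -> I j) ->
  (exists lo (n : nat), (forall i, I i <-> (lo <= i <= lo + n%:Z)%R) /\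
     finite_path (r @` I) n) \/
  ((forall n : nat, exists i, I i /\ I (i + n%:Z)%R) /\
     (ray (r @` I) \/ Defs.line (r @` I))).
Proof.
move=> rl I0 conv.
have up := @down_closed_nat [set n | I (i0 + n%:Z)%R].
have down := @down_closed_nat [set n | I (i0 - n%:Z)%R].
case: up => [||[p up]|up]; rewrite /= ?addr0 //.
- by move=> i j ij Ij; apply: (conv i0 _ _ I0 Ij); lia.
- case: down => [||[q down]|down]; rewrite /= ?subr0 //.
  + by move=> i j ij Ij; apply: (conv _ _ i0 Ij I0); lia.
  + have Iq : forall i, I i <-> (i0 - q%:Z <= i <= i0 - q%:Z + (q + p)%N%:Z)%R.
      move=> i; have [ii|ii] : (i0 <= i)%R \/ (i <= i0)%R by lia.
        have := up (absz (i - i0)%R); rewrite /= (_ : (i0 + _ = i)%R); last lia.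
        move=> ->; lia.
      have := down (absz (i0 - i)%R); rewrite /= (_ : (i0 - _ = i)%R); last lia.
      move=> ->; lia.
    left; exists (i0 - q%:Z)%R, (q + p)%N; split => //.
    rewrite (_ : I = [set i | (i0 - q%:Z <= i <= i0 - q%:Z + (q + p)%N%:Z)%R]).
      exact: finite_path_segment.
    by apply/seteqP; split => i /Iq.
  + right; split.
      by move=> n; exists (i0 - n%:Z)%R; rewrite subrK; split => //; apply: down.
    left; exists (fun n => r (i0 + p%:Z - n%:Z)%R); split.
    * by move=> i j /(geodesic_line_inj rl); lia.
    * move=> n; rewrite adj_sym.
      rewrite (_ : (i0 + p%:Z - n%:Z = i0 + p%:Z - n.+1%:Z + 1)%R); last lia.
      exact: geodesic_line_adj.
    apply/seteqP; split => [_ [i Ii <-]|_ [n _ <-]] /=.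
      exists (absz (i0 + p%:Z - i)%R) => //; congr r.
      suff : (i <= i0 + p%:Z)%R by lia.
      have [ii|] : (i0 <= i)%R \/ (i <= i0)%R by lia.
        have := up (absz (i - i0)%R); rewrite /= (_ : (i0 + _ = i)%R); last lia.
        by move=> [/(_ Ii)]; lia.
      lia.
    exists (i0 + p%:Z - n%:Z)%R => //.
    by apply: (conv (i0 - n%:Z)%R _ (i0 + p%:Z)%R (down n)); [apply/up|lia].
- case: down => [||[q down]|down]; rewrite /= ?subr0 //.
  + by move=> i j ij Ij; apply: (conv _ _ i0 Ij I0); lia.
  + right; split; first by move=> n; exists i0; split => //; apply: up.
    left; exists (fun n => r (i0 - q%:Z + n%:Z)%R); split.
    * by move=> i j /(geodesic_line_inj rl); lia.
    * move=> n.
      rewrite (_ : (i0 - q%:Z + n.+1%:Z = i0 - q%:Z + n%:Z + 1)%R); last lia.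
      exact: geodesic_line_adj.
    apply/seteqP; split => [_ [i Ii <-]|_ [n _ <-]] /=.
      exists (absz (i - i0 + q%:Z)%R) => //; congr r.
      suff : (i0 - q%:Z <= i)%R by lia.
      have [ii|] : (i <= i0)%R \/ (i0 <= i)%R by lia.
        have := down (absz (i0 - i)%R); rewrite /= (_ : (i0 - _ = i)%R); last lia.
        by move=> [/(_ Ii)]; lia.
      lia.
    exists (i0 - q%:Z + n%:Z)%R => //.
    by apply: (conv (i0 - q%:Z)%R _ (i0 + n%:Z)%R _ (up n)); [apply/down|lia].
have IT i : I i.
  by apply: (conv _ _ _ (down (absz (i - i0)%R)) (up (absz (i - i0)%R))); lia.
right; split; first by move=> n; exists i0.
right; exists r; split => [i j /(geodesic_line_inj rl)//|i|].
  exact: geodesic_line_adj.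
by apply/seteqP; split => [_ [i _ <-]|_ [i _ <-]] /=; exists i.
Qed.

(* The two lines meet, and run in the same direction along their
   intersection (either direction if that is a single point). *)
Definition coherent r s := r 0%R = s 0%R /\ forall i j, r i = s j -> i = j.

Lemma overlap_convex r s : geodesic_line r -> geodesic_line s ->
  forall i j k, r i = s i -> r k = s k -> (i <= j <= k)%R -> r j = s j.
Proof.
move=> rl sl i j k ei ek ijk.
by apply: (@geodesic_unique _ (r i) (r k)); rewrite ?ei ?ek ?sl -?ei -?ek ?rl; lia.
Qed.

Lemma coherent_range r s : coherent r s ->
  range r `&` range s = r @` [set i | r i = s i].
Proof.
move=> [_ c]; apply/seteqP; split => [_ [[i _ <-] [j _ e]]|_ [i e <-]] /=.
  by exists i => //=; rewrite {2}(c i j (esym e)).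
by split; exists i.
Qed.

(** The geodesic from [s j] to [r 0 = s 0] runs along [s] and passes through the gate, which is
    therefore common to both lines. *)
Lemma coherent_gate r s j : geodesic_line r -> geodesic_line s -> coherent r s ->
  exists2 m, r m = s m &
    forall i, dist (s j) (r i) = absz (j - m)%R + absz (m - i)%R.
Proof.
move=> rl sl [e0 c]; have [m gate] := line_gate (s j) rl.
have em : r m = s m.
  have := gate 0%R; rewrite e0 sl => e.
  (* [k] lies [absz m] steps from 0 in the direction of [j]. *)
  pose k := (if (0 <= j)%R then (absz m)%:Z else - (absz m)%:Z)%R.
  suff rk : r m = s k by rewrite {2}(c _ _ rk).
  have sm : dist (s 0%R) (r m) = absz m by rewrite -e0 rl; lia.
  apply: (@geodesic_unique _ (s 0%R) (s j)); rewrite ?sl ?sm /k.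
  - by case: ifP; lia.
  - by rewrite distC; lia.
  - by case: ifP; lia.
by exists m => // i; rewrite gate em sl.
Qed.

(** The gate of [s j] has its index between 0 and [j], hence between [i] and [j]. *)
Lemma coherent_dist_across r s i j : geodesic_line r -> geodesic_line s ->
  coherent r s -> (i <= 0 <= j)%R \/ (j <= 0 <= i)%R ->
  dist (s j) (r i) = absz (j - i)%R.
Proof.
move=> rl sl c ij; have [m em gate] := coherent_gate j rl sl c.
by have := gate 0%R; have := gate i; rewrite c.1 sl; lia.
Qed.

(** Index differences of common points agree up to sign; one common point with equal nonzero shifts
    fixes the sign everywhere. *)
Lemma line_orient r s i0 j0 : geodesic_line r -> geodesic_line s -> r i0 = s j0 ->
  coherent (fun i => r (i0 + i)%R) (fun j => s (j0 + j)%R) \/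
  coherent (fun i => r (i0 + i)%R) (fun j => s (j0 - j)%R).
Proof.
move=> rl sl e0.
have H i j i' j' : r i = s j -> r i' = s j' -> absz (i - i')%R = absz (j - j')%R.
  by move=> ij ij'; rewrite -rl -sl ij ij'.
have [[i ri si]|ni] := pselect (exists2 i, r (i0 + i)%R = s (j0 + i)%R & i <> 0%R).
  left; split => [|k l]; first by rewrite !addr0.
  by move=> kl; have := H _ _ _ _ e0 kl; have := H _ _ _ _ ri kl; lia.
right; split => [|k l kl]; first by rewrite addr0 subr0.
have := H _ _ _ _ e0 kl => kl'.
have [//|nkl] := eqVneq k l; case: ni; exists k; last lia.
by rewrite kl; congr s; lia.
Qed.

(** * Inverses, conjugates and products *)

Lemma isom_inv_shift A r (a : nat) : (forall i, A (r i) = r (i + a%:Z)%R) ->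
  forall i, isom_invfun A (r i) = r (i - a%:Z)%R.
Proof. by move=> rS i; rewrite -{1}(subrK a%:Z%R i) -rS isom_funK. Qed.

Lemma isom_inv_distl A x y : dist (isom_invfun A x) y = dist x (A y).
Proof. by rewrite -(isom_dist A) isom_invfunK. Qed.

(* The points [B^-1 A p], [B^-1 q], [p], [A^-1 q], [A^-1 B p] lie in this order
   on a geodesic, which then extends to the axis of [A^-1 B]. *)
Lemma tlen_bridge A B p q : without_inversions (A^-1 * B)%isom ->
  dist (A p) (B p) = dist (A p) q + dist q (B p) ->
  dist (isom_invfun B q) (isom_invfun A q) =
    dist (isom_invfun B q) p + dist p (isom_invfun A q) ->
  0 < dist (A p) q -> 0 < dist q (B p) ->
  tlen (A^-1 * B)%isom = dist (A p) q + dist q (B p).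
Proof.
move=> ni straight_q straight_p a0 b0.
rewrite (tlenE (isom_invfun B (A p)) ni) /= isom_invfunK isom_funK.
have e1 : dist (isom_invfun B (A p)) (isom_invfun B q) = dist (A p) q.
  by rewrite isom_inv_dist.
have e2 : dist (isom_invfun B q) p = dist q (B p) by rewrite isom_inv_distl.
have e3 : dist p (isom_invfun A q) = dist (A p) q.
  by rewrite distC isom_inv_distl distC.
have e4 : dist (isom_invfun A q) (isom_invfun A (B p)) = dist q (B p).
  by rewrite isom_inv_dist.
have e5 : dist p (isom_invfun A (B p)) = dist (A p) (B p).
  by rewrite distC isom_inv_distl distC.
have e6 : dist (isom_invfun B (A p)) p = dist (A p) (B p) by rewrite isom_inv_distl.
have s1 := dist_chain (w := isom_invfun B (A p)) (x := isom_invfun B q) (y := p)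
  (z := isom_invfun A q).
have s2 := dist_chain (w := isom_invfun B (A p)) (x := p) (y := isom_invfun A q)
  (z := isom_invfun A (B p)).
lia.
Qed.

Lemma tlen_inv g : tlen g^-1%isom = tlen g.
Proof.
have le h : tlen h^-1%isom <= tlen h.
  have [x <-] := tlen_attained h.
  by have := tlen_le h^-1%isom (h x); rewrite /= isom_funK distC.
by apply/eqP; rewrite eqn_leq le; exact: (le g^-1%isom).
Qed.

Lemma tlen_mulC g h : tlen (g * h)%isom = tlen (h * g)%isom.
Proof.
have le g' h' : tlen (g' * h')%isom <= tlen (h' * g')%isom.
  have [x <-] := tlen_attained (h' * g')%isom.
  by have := tlen_le (g' * h')%isom (g' x); rewrite /= isom_dist.
by apply/eqP; rewrite eqn_leq !le.
Qed.

Lemma axis_inv g : axis g^-1%isom = axis g.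
Proof.
have e x : dist x (isom_invfun g x) = dist x (g x) by rewrite distC isom_inv_distl.
by apply/seteqP; split => x; rewrite /axis /= tlen_inv e.
Qed.

Lemma without_inversions_inv g : without_inversions g -> without_inversions g^-1%isom.
Proof.
move=> ng x y xy [gx gy]; apply: (ng x y xy).
by split; [rewrite -gy|rewrite -gx]; exact: isom_invfunK.
Qed.

Lemma without_inversions_mulC g h :
  without_inversions (g * h)%isom -> without_inversions (h * g)%isom.
Proof.
move=> ng x y xy [gx gy]; apply: (ng (g x) (g y)).
  by rewrite -dist1_adj isom_dist dist1_adj.
by move: gx gy => /= -> ->.
Qed.

Lemma hyperbolic_inv g : hyperbolic g -> hyperbolic g^-1%isom.
Proof. by case=> ng l0; split; [exact: without_inversions_inv|rewrite tlen_inv]. Qed.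

End Overlaps.

(** * Translation lengths of products *)

(* [L] is the smaller translation length, [S] the intersection of the axes, [S']
   the second intersection, [m <= M] the translation lengths. Subtraction is
   truncated, which accounts for the two subcases of (iii). *)
Definition overlap_cases (T : tree) (S S' : set T) (m M L : nat) : Prop :=
  (exists n, finite_path S n /\
     [\/ n < m /\ L = m + M - 2 * n,
         m < n /\ L = M - m
       | n = m /\ ((exists e, finite_path S' e /\ L = M - m - 2 * e) \/
                   ((ray S' \/ Defs.line S') /\ L = 0))]) \/
  ((ray S \/ Defs.line S) /\ L = M - m).

(** [r i0] and [s j0] realize the minimum, so each is the gate of the other; [dist_chain] glues
    across the bridge, which has positive length. *)
Lemma lines_bridge (T : tree) (r s : int -> T) :
  geodesic_line r -> geodesic_line s -> range r `&` range s = set0 ->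
  exists i0 j0 : int, forall i j : int, dist (r i) (s j) =
    absz (i - i0)%R + set_dist (range r) (range s) + absz (j - j0)%R.
Proof.
move=> rl sl disj; set k := set_dist _ _.
have [] := @leastP [set n | exists x y, [/\ range r x, range s y & dist x y = n]]
  (dist (r 0%R) (s 0%R)); first by exists (r 0%R), (s 0%R); split => //; eexists.
rewrite -/(set_dist _ _) -/k.
move=> [_ [_ [[i0 _ <-] [j0 _ <-] k0]]] min.
have {}min i j : k <= dist (r i) (s j).
  by apply: min; exists (r i), (s j); split => //; eexists.
have kpos : 0 < k.
  rewrite -k0 lt0n; apply/eqP => /dist0_eq e.
  suff : set0 (r i0) by [].
  by rewrite -disj; split; [exists i0|exists j0].
exists i0, j0 => i j.
have gs j' : dist (r i0) (s j') = k + absz (j' - j0)%R.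
  have [n gate] := line_gate (r i0) sl.
  by have := gate j0; have := gate j'; have := min i0 n; lia.
have gr : dist (s j0) (r i) = k + absz (i - i0)%R.
  have [n gate] := line_gate (s j0) rl.
  have := gate i0; have := gate i; have := min n j0.
  rewrite !(distC (s j0)); lia.
have := dist_chain (w := r i) (x := r i0) (y := s j0) (z := s j).
rewrite rl sl !gs (distC _ (s j0)) gr; lia.
Qed.

Lemma tlen_disjoint_axes (T : tree) (A B : tree_isometry T) :
  hyperbolic A -> hyperbolic B -> without_inversions (A^-1 * B)%isom ->
  axis A `&` axis B = set0 ->
  tlen (A^-1 * B)%isom = tlen A + tlen B + 2 * set_dist (axis A) (axis B).
Proof.
move=> hA hB ni disj.
have [r [rl rS rE]] := axis_line hA; have [s [sl sS sE]] := axis_line hB.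
rewrite rE sE in disj *; have [i0 [j0 d]] := lines_bridge rl sl disj.
set k := set_dist _ _ in d *; set a := tlen A in rS *; set b := tlen B in sS *.
have a0 : 0 < a by case: hA. have b0 : 0 < b by case: hB.
have rV := isom_inv_shift rS; have sV := isom_inv_shift sS.
have f1 : dist (s j0) (B (r i0)) = k + b.
  by rewrite -isom_inv_distl sV distC d; lia.
have f2 : dist (s (j0 + b%:Z)%R) (B (r i0)) = k.
  by rewrite -sS isom_dist distC d; lia.
have f3 : dist (s j0) (isom_invfun B (r i0)) = k + b.
  by rewrite distC isom_inv_distl sS d; lia.
have f4 : dist (s (j0 - b%:Z)%R) (isom_invfun B (r i0)) = k.
  by rewrite -sV isom_inv_dist distC d; lia.
have e1 : dist (r i0) (B (r i0)) = b + 2 * k.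
  have := dist_chain (w := r i0) (x := s j0) (y := s (j0 + b%:Z)%R) (z := B (r i0)).
  by rewrite f1 f2 sl !d; lia.
(* Both [p] and [q] are the foot of the bridge on the axis of [A], at distances [a] from [A p] and
   [b + 2 k] from [B p]. *)
rewrite (@tlen_bridge _ A B (r i0) (r i0)) // ?rS ?rV ?rl ?e1; try lia.
- have := dist_chain (w := r (i0 + a%:Z)%R) (x := s j0) (y := s (j0 + b%:Z)%R)
    (z := B (r i0)).
  by rewrite f1 f2 sl !d; lia.
- rewrite [dist _ (r i0)]isom_inv_distl e1 distC.
  have := dist_chain (w := r (i0 - a%:Z)%R) (x := s j0) (y := s (j0 - b%:Z)%R)
    (z := isom_invfun B (r i0)).
  by rewrite f3 f4 sl !d; lia.
Qed.

(** * Axes translated in the same direction *)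

Section CoherentAxes.
Variables (T : tree) (A B : tree_isometry T) (r s : int -> T).
Hypotheses (rl : geodesic_line r) (sl : geodesic_line s).
Local Notation a := (tlen A).
Local Notation b := (tlen B).
Hypotheses (a_gt0 : 0 < a) (b_gt0 : 0 < b).
Hypotheses (rS : forall i, A (r i) = r (i + a%:Z)%R).
Hypotheses (sS : forall i, B (s i) = s (i + b%:Z)%R).
Hypotheses (rE : axis A = range r) (sE : axis B = range s).
Hypothesis (crs : coherent r s).

Let rV := isom_inv_shift rS.
Let sV := isom_inv_shift sS.

(** The common point [r 0] lies between its images under [A^-1] and [B], so [tlen_bridge] applies to
    [A^-1] and [B] with [p = q = r 0]. *)
Lemma tlen_mul_coherent : without_inversions (A * B)%isom ->
  tlen (A * B)%isom = a + b.
Proof.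
move=> ni; have e0 := crs.1.
have across i j := coherent_dist_across (i := i) (j := j) rl sl crs.
have -> : tlen (A * B)%isom = tlen ((A^-1)^-1 * B)%isom by [].
have Br : B (r 0%R) = s b%:Z%R by rewrite e0 sS add0r.
have VBr : isom_invfun B (r 0%R) = s (- b%:Z)%R by rewrite e0 sV sub0r.
have rs j : dist (r 0%R) (s j) = absz j by rewrite e0 sl; lia.
rewrite (@tlen_bridge _ A^-1%isom B (r 0%R) (r 0%R)) //= ?Br ?VBr ?rV ?rS.
- by rewrite rl rs; lia.
- by rewrite distC across ?rl ?rs; lia.
- by rewrite across ?rl ?(distC _ (r 0%R)) ?rs ?rl; lia.
- by rewrite rl; lia.
- by rewrite rs; lia.
Qed.

(** In [tlen_bridge], [p] and [q] are the ends of the overlap: [A p] and [B p] lie beyond [q], at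
    distances [a - n] and [b - n], on branches that part at [q]. *)
Lemma tlen_mulV_short lo (n : nat) : without_inversions (A^-1 * B)%isom ->
  (forall i, r i = s i <-> (lo <= i <= lo + n%:Z)%R) -> n < a -> n < b ->
  tlen (A^-1 * B)%isom = a + b - 2 * n.
Proof.
move=> ni I na nb.
have e0 : r lo = s lo by apply/I; lia.
have en : r (lo + n%:Z)%R = s (lo + n%:Z)%R by apply/I; lia.
have [k /I kI gate] := coherent_gate (lo + b%:Z)%R rl sl crs.
have [k' /I kI' gate'] := coherent_gate (lo + n%:Z - b%:Z)%R rl sl crs.
have := gate (lo + n%:Z)%R; rewrite en sl => g1.
have := gate' lo; rewrite e0 sl => g2.
have Br : B (r lo) = s (lo + b%:Z)%R by rewrite e0 sS.
have VBr : isom_invfun B (r (lo + n%:Z)%R) = s (lo + n%:Z - b%:Z)%R.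
  by rewrite en sV.
have f1 : dist (r (lo + n%:Z)%R) (s (lo + b%:Z)%R) = b - n by rewrite en sl; lia.
have f2 : dist (s (lo + n%:Z - b%:Z)%R) (r lo) = b - n by rewrite e0 sl; lia.
rewrite (@tlen_bridge _ A B (r lo) (r (lo + n%:Z)%R)) // ?rS ?Br ?VBr ?rV.
- by rewrite f1 rl; lia.
- by rewrite f1 rl distC gate; lia.
- by rewrite f2 rl gate'; lia.
- by rewrite rl; lia.
- by rewrite f1; lia.
Qed.

(** [A^-1 B] moves [s (i + a - b)] to [s i], and [s i] to a point [z] at distance [b - a]. If
    [a < b], the common index [i + a + 1] makes the geodesic to [z] leave through [s (i + 1)],
    without backtracking. *)
Lemma tlen_mulV_long i : a <= b -> without_inversions (A^-1 * B)%isom ->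
  r i = s i -> r (i + a%:Z + 1)%R = s (i + a%:Z + 1)%R ->
  tlen (A^-1 * B)%isom = b - a.
Proof.
move=> ab ni e0 ea1.
have conv := overlap_convex rl sl e0 ea1.
have ea : r (i + a%:Z)%R = s (i + a%:Z)%R by apply: conv; lia.
have e1 : r (i + 1)%R = s (i + 1)%R by apply: conv; lia.
have y : B (s (i + a%:Z - b%:Z)%R) = A (s i) by rewrite sS subrK -ea -rS e0.
rewrite (tlenE (s (i + a%:Z - b%:Z)%R) ni) /= y isom_funK sS.
set z := isom_invfun A (s (i + b%:Z)%R).
have z0 : dist (s i) z = b - a.
  by rewrite distC isom_inv_distl -e0 rS ea sl; lia.
have z1 : dist (s (i + 1)%R) z = absz (b%:Z - a%:Z - 1)%R.
  rewrite distC isom_inv_distl -e1 rS (_ : (i + 1 + a%:Z = i + a%:Z + 1)%R); last lia.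
  by rewrite ea1 sl; lia.
have [eab|ltab] := eqVneq a b.
  by rewrite eab addrK distxx subn0 z0 eab.
have := dist_chain (w := s (i + a%:Z - b%:Z)%R) (x := s i) (y := s (i + 1)%R) (z := z).
by rewrite z0 z1 !sl; lia.
Qed.

Lemma axis_conj : axis (A^-1 * B * A)%isom =
  range (fun i => isom_invfun A (s i)).
Proof.
have tB : tlen (A^-1 * B * A)%isom = b.
  apply/eqP; rewrite eqn_leq; apply/andP; split.
    have [x <-] := tlen_attained B.
    have := tlen_le (A^-1 * B * A)%isom (isom_invfun A x).
    by rewrite /= isom_invfunK isom_inv_dist.
  have [x <-] := tlen_attained (A^-1 * B * A)%isom.
  by have := tlen_le B (A x); rewrite /= [in X in _ -> X]distC isom_inv_distl distC.
have axP y : axis (A^-1 * B * A)%isom y <-> axis B (A y).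
  by rewrite /axis /= tB [in X in X <-> _]distC isom_inv_distl distC.
apply/seteqP; split => [y /axP|_ [i _ <-]]; last first.
  by apply/axP; rewrite isom_invfunK sE; exists i.
by rewrite sE => -[i _ e]; exists i => //; rewrite e isom_funK.
Qed.

(* [B] translates away from the axis of [A] along [s] at [lo + a], and
   [A^-1 B] moves [s (lo + a - b)] to [s lo]; the images of these points lie on
   the backward ray of [s] at [lo] and on the forward ray of [A^-1 s] there. The
   overlap of these two rays is the whole intersection of the two lines. *)
Lemma tlen_mulV_equal lo : a <= b -> without_inversions (A^-1 * B)%isom ->
  (forall i, r i = s i <-> (lo <= i <= lo + a%:Z)%R) ->
  let S' := axis B `&` axis (A^-1 * B * A)%isom in
  (exists e, finite_path S' e /\ tlen (A^-1 * B)%isom = b - a - 2 * e) \/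
  ((ray S' \/ Defs.line S') /\ tlen (A^-1 * B)%isom = 0).
Proof.
move=> ab ni I S'.
pose t (i : int) := s (lo - i)%R; pose u i := isom_invfun A (s (lo + a%:Z + i)%R).
have tl : geodesic_line t by move=> i j; rewrite sl; lia.
have ul : geodesic_line u by move=> i j; rewrite isom_inv_dist sl; lia.
have sl' : geodesic_line (fun i => s (lo + i)%R) by move=> i j; rewrite sl; lia.
have ru i : (0 <= a%:Z + i <= a%:Z)%R -> u i = r (lo + i)%R.
  move=> ia; rewrite /u -(I _).2; last lia.
  by rewrite rV; congr r; lia.
have e0 : t 0%R = u 0%R by rewrite ru ?/t ?addr0 ?subr0; [apply/esym/I|]; lia.
(* If [u] followed [s] forwards near [lo], then [r] and [s] would also agree at [lo + a + 1] or at
   [lo - 1]. *)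
have su i : u i = s (lo + i)%R -> i = 0%R.
  move=> e; have e0' : u 0%R = s (lo + 0)%R by rewrite -e0 /t; congr s; lia.
  have [//|i0] := eqVneq i 0%R; have [ip|im] : (0 < i)%R \/ (i < 0)%R by lia.
    have e1 : u 1%R = s (lo + 1)%R.
      by apply: (overlap_convex ul sl' e0' e); lia.
    suff /I : r (lo + a%:Z + 1)%R = s (lo + a%:Z + 1)%R by lia.
    rewrite -(isom_invfunK A (s (lo + a%:Z + 1)%R)) -/(u 1%R) e1 -(I _).2; last lia.
    by rewrite rS; congr r; lia.
  have e1 : u (-1)%R = s (lo + -1)%R by apply: (overlap_convex ul sl' e e0'); lia.
  suff /I : r (lo + -1)%R = s (lo + -1)%R by lia.
  by rewrite -e1 ru //; lia.
have ctu : coherent t u.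
  split => // i j ij.
  have := tl 0%R i; have := ul 0%R j; rewrite -e0 -ij => -> ij'.
  have [//|nij] := eqVneq i j.
  suff : j = 0%R by lia.
  by apply: su; rewrite -ij /t; congr s; lia.
(* At index -1, [t] is at [r (lo + 1)] and [u] at [r (lo - 1)]. *)
have I0 i : t i = u i -> (0 <= i)%R.
  move=> ei; have [//|im] : (0 <= i)%R \/ (i < 0)%R by lia.
  have : t (-1)%R = u (-1)%R by apply: (overlap_convex tl ul ei e0); lia.
  rewrite ru /t; last lia.
  by rewrite -(I _).2 => [/(geodesic_line_inj rl)|]; lia.
have S'E : S' = t @` [set i | t i = u i].
  rewrite -coherent_range // /S' axis_conj sE; congr (_ `&` _).
    apply/seteqP; split => _ [i _ <-]; exists (lo - i)%R => //.
    by rewrite /t; congr s; lia.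
  apply/seteqP; split => _ [i _ <-].
    by exists (i - lo - a%:Z)%R => //; rewrite /u; congr (isom_invfun A (s _)); lia.
  by exists (lo + a%:Z + i)%R.
pose n := (b%:Z - a%:Z)%R.
(* [A^-1 B] sends [t n] to [t 0 = u 0], and this point to [u n]. *)
have tE : tlen (A^-1 * B)%isom = dist (u n) (t n) - (b - a).
  have y : B (t n) = s (lo + a%:Z)%R by rewrite sS /t; congr s; lia.
  have x : isom_invfun A (s (lo + a%:Z)%R) = t 0%R by rewrite e0 /u addr0.
  rewrite (tlenE (t n) ni) /= y x tl {2}/t sS subr0 distC /n /u.
  by congr (dist (isom_invfun A (s _)) _ - _); lia.
rewrite S'E tE.
have [||[lo' [e [Ie fin]]]|[inf path]] :=
    @convex_image_path _ t [set i | t i = u i] 0%R tl.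
- by [].
- by move=> i j k ei ek; apply: (overlap_convex tl ul ei ek).
- left; exists e; split => //.
  (* The overlap has indices 0 to [e], so [t n] and [u n] are at distance [2 (n - min n e)]; less
     [n], this is the truncated [n - 2 e]. *)
  have lo0 : lo' = 0%R by have := I0 _ ((Ie lo').2 _); have /Ie := e0; lia.
  have [k /Ie kI gate] := coherent_gate n tl ul ctu.
  have ee : t (Posz e) = u (Posz e) by apply/Ie; lia.
  have := gate 0%R; have := gate e%:Z%R; have := gate n.
  by rewrite ee e0 !ul => ->; lia.
- right; split => //.
  have [i [ti tin]] := inf (b - a).
  have := I0 _ ti => i0.
  have -> : t n = u n by apply: (overlap_convex tl ul e0 tin); lia.
  by rewrite distxx.
Qed.

Lemma overlap_cases_coherent : a <= b -> without_inversions (A^-1 * B)%isom ->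
  overlap_cases (axis A `&` axis B) (axis B `&` axis (A^-1 * B * A)%isom) a b
    (tlen (A^-1 * B)%isom).
Proof.
move=> ab ni; rewrite [in X in overlap_cases X]rE [in X in overlap_cases X]sE.
rewrite coherent_range //.
have conv := overlap_convex rl sl.
have [||[lo [n [I fin]]]|[inf path]] :=
    @convex_image_path _ r [set i | r i = s i] 0%R rl.
- exact: crs.1.
- by move=> i j k ei ek; apply: conv.
- have r0 : r lo = s lo by apply/I; lia.
  left; exists n; split => //; have [na|na|na] := ltngtP n a.
  + by constructor 1; split => //; apply: (tlen_mulV_short ni I); lia.
  + constructor 2; split => //; apply: (tlen_mulV_long ab ni r0).
    by apply/I; lia.
  + constructor 3; split => //; apply: (@tlen_mulV_equal lo) => // i.
    by rewrite -na; apply: I.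
(* An infinite overlap contains two indices that differ by [a + 1], as the long case requires. *)
- right; split => //; have [i [i0 ia]] := inf a.+1.
  apply: (@tlen_mulV_long i) => //.
  by rewrite -addrA (_ : (a%:Z + 1 = a.+1%:Z)%R); last lia.
Qed.

End CoherentAxes.

Lemma overlap_cases_meet (T : tree) (A B : tree_isometry T) :
  hyperbolic A -> hyperbolic B ->
  without_inversions (A * B)%isom -> without_inversions (A^-1 * B)%isom ->
  tlen A <= tlen B -> axis A `&` axis B <> set0 ->
  maxn (tlen (A * B)%isom) (tlen (A^-1 * B)%isom) = tlen A + tlen B /\
  overlap_cases (axis A `&` axis B) (axis B `&` axis (A^-1 * B * A)%isom)
    (tlen A) (tlen B) (minn (tlen (A * B)%isom) (tlen (A^-1 * B)%isom)).
Proof.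
move=> hA hB nAB nVAB ab /eqP/set0P[x [xA xB]].
have a0 : 0 < tlen A by case: hA. have b0 : 0 < tlen B by case: hB.
have [r [rl rS rE]] := axis_line hA; have [s [sl sS sE]] := axis_line hB.
have [i0 _ ri0] : range r x by rewrite -rE.
have [j0 _ sj0] : range s x by rewrite -sE.
have shift (f : int -> T) (k : int) : range (fun i : int => f (k + i)%R) = range f.
  apply/seteqP; split => _ [i _ <-]; first by eexists.
  by exists (i - k)%R => //; rewrite addrC subrK.
(* Of the two lengths, one equals [tlen A + tlen B]; this bound on the other shows which is the
   minimum. *)
have bound (S S' : set T) L : overlap_cases S S' (tlen A) (tlen B) L -> L <= tlen A + tlen B.
  by case=> [[n [_ [[_ ->]|[_ ->]|[_ [[e [_ ->]]|[_ ->]]]]]]|[_ ->]]; lia.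
pose r' (i : int) := r (i0 + i)%R.
have rl' : geodesic_line r' by move=> i j; rewrite rl; lia.
have rS' i : A (r' i) = r' (i + (tlen A)%:Z)%R by rewrite rS /r' addrA.
have rE' : axis A = range r' by rewrite rE shift.
have [c|c] := line_orient rl sl (etrans ri0 (esym sj0)).
  pose s' (i : int) := s (j0 + i)%R.
  have sl' : geodesic_line s' by move=> i j; rewrite sl; lia.
  have sS' i : B (s' i) = s' (i + (tlen B)%:Z)%R by rewrite sS /s' addrA.
  have sE' : axis B = range s' by rewrite sE shift.
  have oc := overlap_cases_coherent rl' sl' a0 b0 rS' sS' rE' sE' c ab nVAB.
  rewrite (tlen_mul_coherent rl' sl' a0 b0 rS' sS' c nAB).
  by have := bound _ _ _ oc; split; [lia|rewrite (minn_idPr _)].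
(* [A B^-1] and [A^-1 B^-1] are conjugate to the inverses of [A^-1 B] and [A B]. *)
have nABV : without_inversions (A * B^-1)%isom.
  exact: (without_inversions_inv (without_inversions_mulC nVAB)).
have nVABV : without_inversions (A^-1 * B^-1)%isom.
  exact: (without_inversions_inv (without_inversions_mulC nAB)).
have tABV : tlen (A * B^-1)%isom = tlen (A^-1 * B)%isom.
  by rewrite (tlen_mulC A^-1%isom) -(tlen_inv (B * A^-1)%isom).
have tVABV : tlen (A^-1 * B^-1)%isom = tlen (A * B)%isom.
  by rewrite (tlen_mulC A B) -(tlen_inv (B * A)%isom).
pose s' (i : int) := s (j0 - i)%R.
have sl' : geodesic_line s' by move=> i j; rewrite sl; lia.
have b0' : 0 < tlen B^-1%isom by rewrite tlen_inv.
have ab' : tlen A <= tlen B^-1%isom by rewrite tlen_inv.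
have sS' i : B^-1%isom (s' i) = s' (i + (tlen B^-1%isom)%:Z)%R.
  by rewrite tlen_inv /= (isom_inv_shift sS) /s'; congr s; lia.
have sE' : axis B^-1%isom = range s'.
  rewrite axis_inv sE; apply/seteqP; split => _ [i _ <-]; last by eexists.
  by exists (j0 - i)%R => //; rewrite /s'; congr s; lia.
have oc := overlap_cases_coherent rl' sl' a0 b0' rS' sS' rE' sE' c ab' nVABV.
have tm := tlen_mul_coherent rl' sl' a0 b0' rS' sS' c nABV.
have conj : axis (A^-1 * B^-1 * A)%isom = axis (A^-1 * B * A)%isom.
  exact: (axis_inv (A^-1 * B * A)%isom).
rewrite axis_inv conj tlen_inv tVABV in oc; rewrite tABV tlen_inv in tm.
by rewrite tm; have := bound _ _ _ oc; split; [lia|rewrite (minn_idPl _)].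
Qed.

(** * Extended lengths and the case distinction *)

Local Open Scope ring_scope.
Local Open Scope ereal_scope.

Lemma exactly_one3 (P Q R : Prop) : [\/ P, Q | R] ->
  ~ (P /\ Q) -> ~ (P /\ R) -> ~ (Q /\ R) -> exactly_one [:: P; Q; R].
Proof.
move=> PQR nPQ nPR nQR; rewrite /exactly_one; case: PQR => H.
- by exists 0%N; split => // -[|[|[|[]]]] //= H'; tauto.
- by exists 1%N; split => // -[|[|[|[]]]] //= H'; tauto.
- by exists 2%N; split => // -[|[|[|[]]]] //= H'; tauto.
Qed.

Lemma exactly_one2 (P Q : Prop) : P \/ Q -> ~ (P /\ Q) -> exactly_one [:: P; Q].
Proof.
move=> PQ nPQ; rewrite /exactly_one; case: PQ => H.
- by exists 0%N; split => // -[|[|[]]] //= H'; tauto.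
- by exists 1%N; split => // -[|[|[]]] //= H'; tauto.
Qed.

(** Comparison of [Delta] with [m] separates the cases; an infinite [Delta] falls into the
    second. *)
Lemma exactly_one_overlap (T : tree) (S S' : set T) (m M L : nat) :
  (m <= M)%N -> overlap_cases S S' m M L ->
  exists2 Delta : \bar int, path_of_length S Delta &
    exactly_one [::
      Delta < (m%:Z)%:E /\ (L%:Z)%:E = ((m + M)%N%:Z)%:E - 2%:E * Delta;
      (m%:Z)%:E < Delta /\ L = (M - m)%N;
      Delta = (m%:Z)%:E /\
      exists Delta' : \bar int, path_of_length S' Delta' /\
        (L%:Z)%:E = (if 2%:E * Delta' < ((M - m)%N%:Z)%:E
                     then ((M - m)%N%:Z)%:E - 2%:E * Delta' else 0)].
Proof.
move=> mM cases.
have trichotomy (Delta : \bar int) (P Q R : Prop) :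
    [\/ Delta < (m%:Z)%:E /\ P, (m%:Z)%:E < Delta /\ Q
      | Delta = (m%:Z)%:E /\ R] ->
    exactly_one [:: Delta < (m%:Z)%:E /\ P; (m%:Z)%:E < Delta /\ Q;
      Delta = (m%:Z)%:E /\ R].
  move=> H; apply: exactly_one3 => //.
  - by move=> [[l1 _] [l2 _]]; have := lt_trans l1 l2; rewrite ltxx.
  - by move=> [[lt _] [e _]]; rewrite e ltxx in lt.
  - by move=> [[lt _] [e _]]; rewrite e ltxx in lt.
case: cases => [[n [fin cases]]|[inf ->]]; last first.
  exists +oo; first by right.
  by apply: trichotomy; constructor 2; rewrite ltry.
exists (n%:Z)%:E; first by left; exists n.
apply: trichotomy; rewrite !lte_fin.
case: cases => [[nm ->]|[mn ->]|[-> cases]].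
- constructor 1; split; first lia.
  by rewrite -EFinM -EFinB; congr EFin; lia.
- by constructor 2; split => //; lia.
constructor 3; split => //; case: cases => [[e [fin' ->]]|[inf ->]].
  exists (e%:Z)%:E; split; first by left; exists e.
  (* The truncated difference vanishes exactly when the strict inequality fails. *)
  rewrite -EFinM lte_fin; case: ifP => ee.
    by rewrite -EFinB; congr EFin; lia.
  by congr EFin; lia.
exists +oo; split; first by right.
by rewrite mulry gtr0_sg // mul1e ltNge leey.
Qed.

Theorem proposition3p5 (T : tree) (A B : tree_isometry T)
    (hA : hyperbolic A) (hB : hyperbolic B)
    (hAB : without_inversions (A * B)%isom)
    (hAVB : without_inversions (A^-1 * B)%isom) :
  let a := tlen A in
  let b := tlen B in
  let lmax := maxn (tlen (A * B)%isom) (tlen (A^-1 * B)%isom) in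
  let lmin := minn (tlen (A * B)%isom) (tlen (A^-1 * B)%isom) in
  let diff := absz (a%:Z - b%:Z)%R in
  exactly_one [::
    (* (1) *)
    axis A `&` axis B = set0 /\
    (let k := set_dist (axis A) (axis B) in
     tlen (A * B)%isom = (a + b + 2 * k)%N /\
     tlen (A^-1 * B)%isom = (a + b + 2 * k)%N);
    (* (2) *)
    exists Delta : \bar int,
      [/\ path_of_length (axis A `&` axis B) Delta,
          lmax = (a + b)%N
        & exactly_one [::
            (* (i) *)
            Delta < ((minn a b)%:Z)%:E /\
            (lmin%:Z)%:E = ((a + b)%N%:Z)%:E - 2%:E * Delta;
            (* (ii) *)
            ((minn a b)%:Z)%:E < Delta /\ lmin = diff;
            (* (iii) *)
            Delta = ((minn a b)%:Z)%:E /\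
            exists Delta' : \bar int,
              path_of_length
                (if (a <= b)%N then axis B `&` axis (A^-1 * B * A)%isom
                 else axis A `&` axis (B^-1 * A * B)%isom) Delta' /\
              (lmin%:Z)%:E =
                (if 2%:E * Delta' < (diff%:Z)%:E
                 then (diff%:Z)%:E - 2%:E * Delta' else 0)]]].
Proof.
move=> a b lmax lmin diff; apply: exactly_one2; last first.
  (* The alternatives exclude each other because every path, ray or line has a vertex. *)
  move=> [[disj _] [Delta [path _ _]]]; suff [x] : axis A `&` axis B !=set0.
    by rewrite disj.
  case: path => [[n _ [x [p [_ _ _ ->]]]]|[_ [[r [_ _ ->]]|[r [_ _ ->]]]]].
  - by exists x; rewrite /= mem_head.
  - by exists (r 0%N), 0%N.
  - by exists (r 0%R), 0%R.
have [disj|meet] := pselect (axis A `&` axis B = set0).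
  left; split => //; split; last exact: tlen_disjoint_axes.
  (* [A^-1] has the same axis and translation length as [A], which gives the length of [A B]. *)
  have := tlen_disjoint_axes (hyperbolic_inv hA) hB hAB.
  by rewrite axis_inv tlen_inv; apply.
right; have [ab|ba] := leqP a b.
  have [lmaxE cases] := overlap_cases_meet hA hB hAB hAVB ab meet.
  have [Delta path one] := exactly_one_overlap ab cases.
  exists Delta; split => //.
  by have -> : diff = (b - a)%N by lia.
(* For [b < a] the roles of [A] and [B] are exchanged, which preserves both lengths. *)
have tBA : tlen (B * A)%isom = tlen (A * B)%isom by rewrite tlen_mulC.
have tVBA : tlen (B^-1 * A)%isom = tlen (A^-1 * B)%isom.
  by rewrite -(tlen_inv (A^-1 * B)%isom).
have hBA := without_inversions_mulC hAB.
have hVBA : without_inversions (B^-1 * A)%isom := without_inversions_inv hAVB.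
rewrite setIC in meet.
have [lmaxE cases] := overlap_cases_meet hB hA hBA hVBA (ltnW ba) meet.
have [Delta path one] := exactly_one_overlap (ltnW ba) cases.
rewrite tBA tVBA -/lmax -/lmin in lmaxE one.
exists Delta; rewrite setIC addnC; split => //.
have -> : diff = (a - b)%N by lia.
exact: one.
Qed.
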